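(* Let $A$ be an $n\times n$ integer matrix with nonzero determinant that is diagonalizable, and assume that for each eigenvalue $\lambda$ of $A$ of maximum modulus, $\lambda/\bar\lambda$ is a root of unity. Let $|\lambda_1|$ denote the maximum modulus of the eigenvalues of $A$ and $|\lambda_2|$ the largest modulus of an eigenvalue of $A$ that is strictly smaller than $|\lambda_1|$. Then there are a positive integer $p$ and $p$ constants $C_0,C_1,\dots,C_{p-1}\ge 1$ such that $$\deg(f_A^{pk+l})=C_l\cdot|\lambda_1|^{pk+l}+O(|\lambda_2|^{pk+l})\qquad (k\to\infty)$$ for $l=0,1,\dots,p-1$.
   Context: For an integer matrix $A=(a_{i,j})$ of size $n\times n$, $f_A$ denotes the monomial map $f_A(x_1,\dots,x_n)=(\prod_j x_j^{a_{1,j}},\dots,\prod_j x_j^{a_{n,j}})$ and also the rational map $\mathbb{P}^n\dashrightarrow\mathbb{P}^n$ it induces via the embedding $(X_1,\dots,X_n)\mapsto[1;X_1;\dots;X_n]$. $f_A^k$ is the $k$-th iterate, equal to $f_{A^k}$. The degree $\deg(f)$ of a rational map $f:\mathbb{P}^n\dashrightarrow\mathbb{P}^n$ is the common degree of the homogeneous polynomials without common factor defining $f$ (equivalently, the integer by which $f^*$ acts on $\mathrm{Pic}(\mathbb{P}^n)\cong\mathbb{Z}$). Diagonalizable means diagonalizable over $\mathbb{C}$. If all eigenvalues of $A$ have the same modulus, the error term is understood to be $0$. *)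

(* Defs.v *)
From HB Require Import structures.
From mathcomp Require Import all_boot all_order all_algebra.
From mathcomp Require Import boolp classical_sets.
From mathcomp Require Import complex mpoly.

Set Implicit Arguments.
Unset Strict Implicit.
Unset Printing Implicit Defensive.

Import Order.TTheory GRing.Theory Num.Theory.
Local Open Scope ring_scope.

Section RationalMaps.
Variables (K : fieldType) (n : nat).

Definition in_torus (x : 'rV[K]_n) : Prop := forall j, x 0 j != 0.

Definition monomial_map (A : 'M[int]_n) (x : 'rV[K]_n) : 'rV[K]_n :=
  \row_i \prod_j x 0 j ^ A i j.

(* [x_1, ..., x_n] |-> [1; x_1; ...; x_n] *)
Definition proj_embed (x : 'rV[K]_n) : 'rV[K]_(1 + n) := row_mx 1 x.

(* The second clause excludes F = 0, so the common degree d is determined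
   by F. *)
Definition coprime_forms (d : nat) (F : 'I_(1 + n) -> {mpoly K[1 + n]}) : Prop :=
  (forall i, F i \is d.-homog) /\
  (forall H, (forall i, exists Q, F i = H * Q) -> H \is a GRing.unit).

(* [F_0; ...; F_n] is the rational self-map of P^n that extends the map f of
   the torus.  The factor c may vanish on the indeterminacy locus of F; if it
   vanished on the whole torus, F would be 0 (K infinite). *)
Definition extends_to (f : 'rV[K]_n -> 'rV[K]_n)
    (F : 'I_(1 + n) -> {mpoly K[1 + n]}) : Prop :=
  forall x, in_torus x -> exists c, forall i,
    (F i).@[fun j => proj_embed x 0 j] = c * proj_embed (f x) 0 i.

Definition is_ratmap_degree (f : 'rV[K]_n -> 'rV[K]_n) (d : nat) : Prop :=
  exists F, coprime_forms d F /\ extends_to f F.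

(* The default value 0 matters only if f does not extend to a rational self-map
   of P^n; monomial maps and their iterates always do. *)
Definition ratmap_degree (f : 'rV[K]_n -> 'rV[K]_n) : nat :=
  xget 0%N [set d | is_ratmap_degree f d]%classic.

End RationalMaps.

Section Moduli.
Variables (R : rcfType) (n : nat).

Definition complex_mx (A : 'M[int]_n) : 'M[R[i]]_n := map_mx intr A.

Definition eigen_modulus (A : 'M[int]_n) (r : R) : Prop :=
  exists2 a : R[i], eigenvalue (complex_mx A) a & ComplexField.Normc.normc a = r.

Definition max_modulus (A : 'M[int]_n) (r : R) : Prop :=
  eigen_modulus A r /\ forall s, eigen_modulus A s -> s <= r.

Definition second_modulus (A : 'M[int]_n) (r1 r2 : R) : Prop :=
  [/\ eigen_modulus A r2, r2 < r1 &
      forall s, eigen_modulus A s -> s < r1 -> s <= r2].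

End Moduli.

(* Main.v *)
Require Import Defs.
From mathcomp Require Import all_boot all_order all_algebra.
From mathcomp Require Import boolp classical_sets.
From mathcomp Require Import complex.
From mathcomp Require mpoly.
From mathcomp Require Import ring.

(** The degree of a monomial map is a piecewise linear function of its matrix,
    and this turns an asymptotic statement about degrees into linear algebra.

    Write [f_B] in homogeneous coordinates: its i-th component is a Laurent
    monomial of total degree 0, with exponents the i-th row of a matrix [E]
    that depends linearly on [B] ([homog_exponents]).  Multiplying all the
    components by the smallest monomial that clears the poles gives coprime
    forms, hence
      deg f_B = D(B) := sum_j max_i (- E i j)       ([ratmap_degree_monomial]),
    the i = 0 row of [E] being 0.  Coprime forms extending [f_B] are unique up
    to a constant because a polynomial that vanishes on the torus is zero.

    [D] makes sense for real matrices.  It is subadditive and positively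
    homogeneous, therefore Lipschitz, and it dominates the modulus of every
    eigenvalue of [B] ([eigenvalue_le_trop_degree]): on vectors (0, v), the
    diameter of the set of coordinates is a norm that [B] multiplies by at most
    D(B).

    Let [A] be diagonalizable with dominant modulus rho.  For an eigenvalue a
    of modulus rho, a / conj a = (a / rho)^2, so a / rho is a root of unity;
    let p be a common period of these phases.  With m = p * k + l,
      A^m = rho^m M_l + E_m,
    where M_l has the eigenvectors of [A], with eigenvalue (a / rho)^l where
    |a| = rho and 0 elsewhere, and E_m involves only the other eigenvalues.
    Since [A] is real and the recipe commutes with conjugation, M_l is real
    ([dominant_mxE]), so
      D(A^m) = rho^m D(M_l) + O(|E_m|)               ([dominant_approx]).
    The constants are C_l = D(M_l), and C_l >= 1 because M_l has an eigenvalue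
    of modulus 1. *)

Set Implicit Arguments.
Unset Strict Implicit.
Unset Printing Implicit Defensive.

Import Order.TTheory GRing.Theory Num.Theory.
Local Open Scope ring_scope.

Local Notation normc := ComplexField.Normc.normc.

(** * The degree function on matrices *)

Section TropicalDegree.
Variable T : realDomainType.
Variable n : nat.
Implicit Type B : 'M[T]_n.

(** Exponents of the components of [f_B] in the homogeneous coordinates
    [X_0, ..., X_n] with [x_j = X_j / X_0]: column 0 makes every row sum to 0,
    and row 0 is the constant component 1. *)
Definition homog_exponents B : 'M[T]_(1 + n) :=
  block_mx 0 0 (- (B *m const_mx 1)) B.

Definition pole_order B (j : 'I_(1 + n)) : T :=
  \big[Num.max/0]_i (- homog_exponents B i j).

Definition trop_degree B : T := \sum_j pole_order B j.

Lemma homog_exponents_row0 B j : homog_exponents B (lshift n 0) j = 0.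
Proof.
by rewrite /homog_exponents; case: (split_ordP j) => k ->;
  rewrite ?block_mxEul ?block_mxEur mxE.
Qed.

Lemma homog_exponents_rowr B i j :
  homog_exponents B (rshift 1 i) (rshift 1 j) = B i j.
Proof. by rewrite /homog_exponents block_mxEdr. Qed.

Lemma sum_homog_exponents B i : \sum_j homog_exponents B i j = 0.
Proof.
case: (split_ordP i) => k ->; last first.
  rewrite big_split_ord big_ord1 /= {1}/homog_exponents block_mxEdl !mxE.
  under [X in _ + X]eq_bigr do rewrite homog_exponents_rowr.
  by under [X in - X]eq_bigr do rewrite mxE mulr1; rewrite addNr.
by rewrite ord1 big1// => j _; rewrite homog_exponents_row0.
Qed.

Lemma pole_order_ge0 B j : 0 <= pole_order B j.
Proof. exact: bigmax_ge_id. Qed.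

Lemma pole_order_ge B i j : 0 <= homog_exponents B i j + pole_order B j.
Proof. by rewrite addrC -lerBlDr sub0r; exact: le_bigmax. Qed.

(** After the poles are cleared, no coordinate divides every component: this is
    what makes the components coprime. *)
Lemma pole_orderP B j : exists i, homog_exponents B i j + pole_order B j = 0.
Proof.
suff [i <-] : exists i, - homog_exponents B i j = pole_order B j.
  by exists i; rewrite subrr.
rewrite /pole_order.
elim/big_ind: _ => [|x y [ix <-] [iy <-]|i _]; last by exists i.
  by exists (lshift n 0); rewrite homog_exponents_row0 oppr0.
by case: leP => _; [exists iy | exists ix].
Qed.

Lemma trop_degree_ge0 B : 0 <= trop_degree B.
Proof. by apply: sumr_ge0 => j _; exact: pole_order_ge0. Qed.

Lemma sum_shifted_exponents B i :
  \sum_j (homog_exponents B i j + pole_order B j) = trop_degree B.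
Proof. by rewrite big_split/= sum_homog_exponents add0r. Qed.

End TropicalDegree.

(** * The degree of a monomial map *)

Module Degree.
Import mpoly.

Section Vanishing.

Lemma digits_inj b N (u v : 'I_N -> nat) :
    (forall j, (u j < b)%N) -> (forall j, (v j < b)%N) ->
  (\sum_j u j * b ^ j = \sum_j v j * b ^ j)%N -> u =1 v.
Proof.
elim: N u v => [|N IH] u v ub vb; first by move=> _ [].
have b0 : (0 < b)%N by exact: leq_ltn_trans (ub ord0).
have split w : (\sum_(j < N.+1) w j * b ^ j =
    (\sum_(j < N) w (lift ord0 j) * b ^ j) * b + w ord0)%N.
  rewrite big_ord_recl /= expn0 muln1 addnC; congr (_ + _)%N.
  by rewrite big_distrl/=; apply: eq_bigr => j _; rewrite expnSr mulnA.
rewrite !split => e.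
have e0 : u ord0 = v ord0.
  by move/(congr1 (modn^~ b)): e; rewrite /= !modnMDl !modn_small.
have eS : (\sum_(j < N) u (lift ord0 j) * b ^ j =
           \sum_(j < N) v (lift ord0 j) * b ^ j)%N.
  by move/(congr1 (divn^~ b)): e; rewrite /= !divnMDl// !divn_small// !addn0.
move=> j; case: (unliftP ord0 j) => [k ->|->//].
exact: (IH (fun k => u (lift ord0 k)) (fun k => v (lift ord0 k))).
Qed.

(** Kronecker substitution: along the curve [y_j = t ^ (b ^ j)], with [b] larger
    than all the exponents of [p], distinct monomials restrict to distinct powers
    of [t], so that [p] becomes a univariate polynomial with the same
    coefficients. *)
Lemma mpoly_torus_eq0 (K : numFieldType) N (p : {mpoly K[N]}) :
  (forall y : 'I_N -> K, (forall j, y j != 0) -> p.@[y] = 0) -> p = 0.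
Proof.
move=> p0; pose b := msize p.
pose w (m : 'X_{1..N}) := (\sum_j m j * b ^ j)%N.
pose q : {poly K} := \sum_(m <- msupp p) p@_m *: 'X^(w m).
have q0 : q = 0.
  apply/eqP; apply: contraT => qN0.
  (* Nonzero elements of K, more numerous than the degree of q allows. *)
  pose s : seq K := [seq k.+1%:R | k <- iota 0 (size q)].
  have := @max_poly_roots _ q s qN0; rewrite size_map size_iota ltnn => -> //.
    apply/allP => _ /mapP[k _ ->]; apply/rootP.
    rewrite -[RHS](p0 (fun j => k.+1%:R ^+ (b ^ j))); last first.
      by move=> j; rewrite expf_neq0// pnatr_eq0.
    rewrite mevalE /q horner_sum; apply: eq_bigr => m _.
    rewrite hornerZ hornerXn /w expr_sum; congr (_ * _).
    by apply: eq_bigr => j _; rewrite -exprM mulnC.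
  rewrite map_inj_uniq ?iota_uniq//.
  exact: inj_comp (mulrIn (oner_neq0 K)) succn_inj.
have w_inj : {in msupp p &, injective w}.
  have lt_b m j : m \in msupp p -> (m j < b)%N.
    move=> /msize_mdeg_lt; apply: leq_ltn_trans.
    by rewrite mdegE (bigD1 j)//= leq_addr.
  move=> m m' mp mp' e; apply/mnmP.
  by apply: (@digits_inj b) => [j|j|]; [exact: lt_b | exact: lt_b | exact: e].
apply/mpolyP => m; rewrite mcoeff0.
have [mp|] := boolP (m \in msupp p); last exact: memN_msupp_eq0.
have := congr1 (fun r : {poly K} => r`_(w m)) q0; rewrite coef0 => <-.
rewrite /q coef_sum (bigD1_seq m) ?msupp_uniq//= coefZ coefXn eqxx mulr1.
rewrite big_seq_cond big1 ?addr0// => m' /andP[m'p m'm].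
by rewrite coefZ coefXn (inj_in_eq w_inj)// eq_sym (negbTE m'm) mulr0.
Qed.

Lemma meval_homog (K : fieldType) N d (p : {mpoly K[N]}) t (y : 'I_N -> K) :
  p \is d.-homog -> p.@[fun j => t * y j] = t ^+ d * p.@[y].
Proof.
move=> ph; rewrite !mevalE mulr_sumr !big_seq; apply: eq_bigr => m mp.
rewrite mulrCA; congr (_ * _).
rewrite -(dhomog_mf ph mp) /= mdegE expr_sum -big_split/=.
by apply: eq_bigr => j _; rewrite exprMn.
Qed.
End Vanishing.

Section Coprime.
Variables (K : fieldType) (n : nat) (g : 'I_(1 + n) -> 'X_{1..1 + n}).
Hypothesis g0 : forall j, exists i, g i j = 0%N.

Lemma mpolyX_neq0 (m : 'X_{1..1 + n}) : 'X_[K, m] != 0.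
Proof. by rewrite -mleadc_eq0 mleadXm mcoeffX eqxx oner_neq0. Qed.

(** The leading monomial of a common divisor divides every [g i], hence is 1;
    as the monomial order is graded, the divisor is constant. *)
Lemma monomials_coprime (H : {mpoly K[1 + n]}) :
  (forall i, exists Q, 'X_[g i] = H * Q) -> H \is a GRing.unit.
Proof.
move=> HX; have HN0 : H != 0.
  apply/eqP => H0; have [Q /eqP] := HX 0.
  by rewrite H0 mul0r (negbTE (mpolyX_neq0 _)).
have leadH j : mlead H j = 0%N.
  have [i gi0] := g0 j; have [Q HQ] := HX i.
  have QN0 : Q != 0.
    by apply: contraNneq (mpolyX_neq0 (g i)) => Q0; rewrite HQ Q0 mulr0.
  have := congr1 (fun p => mlead p j) HQ.
  rewrite mleadXm mleadM// mnmDE gi0 => /esym/eqP.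
  by rewrite addn_eq0 => /andP[/eqP].
have HC : H = (H@_0)%:MP.
  apply/msize1_polyC; rewrite -mlead_deg//.
  by rewrite (_ : mlead H = 0%MM) ?mdeg0//; apply/mnmP => j; rewrite leadH mnm0E.
apply/andP; split; first exact/eqP.
by rewrite unitfE; apply: contraNneq HN0 => c0; rewrite HC c0 mpolyC0.
Qed.

(** Uniqueness of the homogeneous representation, without unique factorization
    in polynomial rings: for each variable [j] take [k] with [g k j = 0]; then
    [F i * 'X_[g k] = F k * 'X_[g i]] shows that ['X_j ^+ g i j] divides every
    monomial of [F i]. *)
Lemma proportional_to_monomials (F : 'I_(1 + n) -> {mpoly K[1 + n]}) :
  (forall i k, F i * 'X_[g k] = F k * 'X_[g i]) ->
  exists H, forall i, F i = H * 'X_[g i].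
Proof.
move=> FX.
have gF i m : m \in msupp (F i) -> (g i <= m)%MM.
  move=> mF; apply/mnm_lepP => j; have [k gk0] := g0 j.
  have : (g k + m)%MM \in msupp (F i * 'X_[g k]).
    by rewrite (perm_mem (msuppMX _ _)) map_f.
  rewrite FX (perm_mem (msuppMX _ _)) => /mapP[m' _ /mnmP/(_ j)].
  by rewrite !mnmDE gk0 add0n => ->; rewrite leq_addr.
pose H i := \sum_(m <- msupp (F i)) (F i)@_m *: 'X_[K, (m - g i)].
have FH i : F i = H i * 'X_[g i].
  rewrite {1}[F i]mpolyE mulr_suml !big_seq; apply: eq_bigr => m mF.
  by rewrite -scalerAl -mpolyXD submK// gF.
exists (H 0) => i; rewrite FH; congr (_ * _).
have := FX i 0; rewrite (FH i) (FH 0) -mulrA [in RHS]mulrAC -mulrA => e.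
by apply: (mulIf (x := 'X_[g i] * 'X_[g 0])) => //; rewrite mulf_neq0 ?mpolyX_neq0.
Qed.

End Coprime.

Section MonomialDegree.
Variables (K : numFieldType) (n : nat) (B : 'M[int]_n).

(** Row [i] of [homog_exponents B] after multiplication by the monomial that
    clears the poles; [absz] acts on nonnegative integers only. *)
Definition mono_exponent (i : 'I_(1 + n)) : 'X_{1..1 + n} :=
  [multinom absz (homog_exponents B i j + pole_order B j)%R | j < 1 + n].

Lemma mdeg_mono_exponent i : mdeg (mono_exponent i) = `|trop_degree B|%N.
Proof.
suff : Posz (mdeg (mono_exponent i)) = `|trop_degree B|%N by case.
rewrite gez0_abs ?trop_degree_ge0// -(sum_shifted_exponents B i).
rewrite mdegE (big_morph Posz PoszD (erefl _)).
by apply: eq_bigr => j _; rewrite mnmE gez0_abs ?pole_order_ge.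
Qed.

Lemma mono_exponent_eq0 j : exists i, mono_exponent i j = 0%N.
Proof. by have [i e] := pole_orderP B j; exists i; rewrite mnmE e. Qed.

Lemma proj_embed_neq0 (x : 'rV[K]_n) j : in_torus x -> proj_embed x 0 j != 0.
Proof.
move=> xT; case: (split_ordP j) => k ->; rewrite /proj_embed.
  by rewrite row_mxEl ord1 mxE oner_neq0.
by rewrite row_mxEr.
Qed.

Lemma proj_embed_monomial_map (x : 'rV[K]_n) i : in_torus x ->
  \prod_j proj_embed x 0 j ^ homog_exponents B i j =
  proj_embed (monomial_map B x) 0 i.
Proof.
move=> xT; rewrite {2}/proj_embed; case: (split_ordP i) => k ->.
  rewrite ord1 row_mxEl mxE big1// => j _.
  by rewrite homog_exponents_row0 expr0z.
rewrite row_mxEr mxE big_split_ord big_ord1 /=.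
rewrite /proj_embed row_mxEl mxE exp1rz mul1r.
by apply: eq_bigr => j _; rewrite row_mxEr homog_exponents_rowr.
Qed.

Lemma meval_mono_exponent (x : 'rV[K]_n) : in_torus x ->
  exists c, forall i, 'X_[mono_exponent i].@[fun j => proj_embed x 0 j] =
    c * proj_embed (monomial_map B x) 0 i.
Proof.
move=> xT; exists (\prod_j proj_embed x 0 j ^ pole_order B j) => i.
rewrite -proj_embed_monomial_map// mevalX -big_split/=.
apply: eq_bigr => j _; rewrite mnmE exprnP gez0_abs ?pole_order_ge//.
by rewrite addrC expfzDr// proj_embed_neq0.
Qed.

Lemma dehomogenize (y : 'I_(1 + n) -> K) : (forall j, y j != 0) ->
  exists2 x : 'rV[K]_n, in_torus x & forall j, y j = y 0 * proj_embed x 0 j.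
Proof.
move=> y0; exists (\row_j (y (rshift 1 j) / y 0)) => [j|j].
  by rewrite mxE mulf_neq0// invr_neq0.
rewrite /proj_embed; case: (split_ordP j) => k ->.
  by rewrite row_mxEl ord1 !mxE mulr1; congr y; apply: val_inj.
by rewrite row_mxEr mxE mulrC divfK.
Qed.

(** Two homogeneous representations of the same map on the torus have equal
    cross products, since homogeneity carries the equality from the points
    [[1; x]] to the whole torus of the affine cone. *)
Lemma extension_proportional (f : 'rV[K]_n -> 'rV[K]_n) d F :
    (forall x, in_torus x -> f x = monomial_map B x) ->
    (forall i, F i \is d.-homog) -> extends_to f F ->
  forall i k, F i * 'X_[mono_exponent k] = F k * 'X_[mono_exponent i].
Proof.
move=> fB Fh Ff i k; apply/eqP; rewrite -subr_eq0; apply/eqP.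
apply: mpoly_torus_eq0 => y /dehomogenize[x xT yx].
rewrite mevalB !mevalM !(meval_eq _ yx) !(meval_homog _ _ (Fh _)).
have Xh l : 'X_[K, mono_exponent l] \is `|trop_degree B|%N.-homog.
  by rewrite dhomogX/= mdeg_mono_exponent.
rewrite !(meval_homog _ _ (Xh _)).
have [c Fc] := Ff x xT; have [c' Xc] := meval_mono_exponent xT.
rewrite !Fc !Xc fB//; set a := _ ^+ d; set b := _ ^+ `|_|.
have swap u v s t :
    a * (u * s) * (b * (v * t)) - a * (u * t) * (b * (v * s)) = 0.
  by ring.
exact: swap.
Qed.

(** The monomials [mono_exponent i] are coprime forms that extend [f], and they
    divide any other such forms with a common quotient, which is a unit by
    coprimality. *)
Lemma is_ratmap_degree_monomial (f : 'rV[K]_n -> 'rV[K]_n) d :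
    (forall x, in_torus x -> f x = monomial_map B x) ->
  is_ratmap_degree f d <-> d = `|trop_degree B|%N.
Proof.
move=> fB; split=> [[F [[Fh Fcop] Ff]]|->].
  have [H FH] := proportional_to_monomials mono_exponent_eq0
    (extension_proportional fB Fh Ff).
  have Hunit : H \is a GRing.unit.
    by apply: Fcop => i; eexists; exact: FH.
  have FN0 : F 0 != 0.
    rewrite FH mulf_neq0 ?mpolyX_neq0//.
    by apply: contraTneq Hunit => ->; rewrite unitr0.
  apply: (dhomog_uniq FN0 (Fh 0)).
  have /andP[/eqP HC _] := Hunit.
  by rewrite FH HC mul_mpolyC dhomogZ// dhomogX/= mdeg_mono_exponent.
exists (fun i => 'X_[mono_exponent i]); split; first split.
- by move=> i; rewrite dhomogX/= mdeg_mono_exponent.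
- exact: monomials_coprime mono_exponent_eq0.
- move=> x xT; have [c Xc] := meval_mono_exponent xT.
  by exists c => i; rewrite fB.
Qed.

Lemma ratmap_degree_monomial (f : 'rV[K]_n -> 'rV[K]_n) :
    (forall x, in_torus x -> f x = monomial_map B x) ->
  ratmap_degree f = `|trop_degree B|%N.
Proof.
move=> fB; rewrite /ratmap_degree; apply: xget_subset1.
  exact/is_ratmap_degree_monomial.
by move=> d e /(is_ratmap_degree_monomial _ fB)->
  /(is_ratmap_degree_monomial _ fB)->.
Qed.

End MonomialDegree.

Section Iterates.
Variables (K : numFieldType) (n : nat).

Lemma monomial_map_comp (A B : 'M[int]_n) (x : 'rV[K]_n) : in_torus x ->
  monomial_map A (monomial_map B x) = monomial_map (A *m B) x.
Proof.
move=> xT; apply/rowP => i; rewrite !mxE.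
transitivity (\prod_j \prod_k x 0 k ^ (A i j * B j k)).
  apply: eq_bigr => j _; rewrite mxE.
  rewrite (big_morph (fun z => z ^ A i j) (id1 := 1) (op1 := *%R)) ?exp1rz//.
    by apply: eq_bigr => k _; rewrite exprz_exp mulrC.
  by move=> u v; rewrite expfzMl.
rewrite exchange_big/=; apply: eq_bigr => k _; rewrite mxE.
rewrite (big_morph (fun z => x 0 k ^ z) (id1 := 1) (op1 := *%R)) ?expr0z//.
by move=> u v; rewrite expfzDr.
Qed.

Lemma iter_monomial_map (A : 'M[int]_n) k (x : 'rV[K]_n) : in_torus x ->
  iter k (monomial_map A) x = monomial_map (A ^+ k) x.
Proof.
move=> xT; elim: k => [|k IH].
  apply/rowP => i; rewrite expr0 mxE (bigD1 i)//= mxE eqxx expr1z.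
  by rewrite big1 ?mulr1// => j ji; rewrite mxE eq_sym (negbTE ji) expr0z.
by rewrite iterS IH monomial_map_comp// exprS.
Qed.

Lemma ratmap_degree_iter (A : 'M[int]_n) k :
  ratmap_degree (iter k (@monomial_map K n A)) = `|trop_degree (A ^+ k)|%N.
Proof. by apply: ratmap_degree_monomial => x; exact: iter_monomial_map. Qed.

End Iterates.
End Degree.

(** * Sublinearity of the degree function *)

Section Sublinearity.
Variables (T : realDomainType) (n : nat).
Implicit Types B C : 'M[T]_n.

Lemma homog_exponentsD B C :
  homog_exponents (B + C) = homog_exponents B + homog_exponents C.
Proof. by rewrite add_block_mx !addr0 -opprD -mulmxDl. Qed.

Lemma homog_exponentsZ a B :
  homog_exponents (a *: B) = a *: homog_exponents B.
Proof. by rewrite scale_block_mx !scaler0 scalerN scalemxAl. Qed.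

Lemma pole_order_le B j x :
  (forall i, - homog_exponents B i j <= x) -> pole_order B j <= x.
Proof.
move=> Bx; apply: bigmax_le => //.
by have := Bx (lshift n 0); rewrite homog_exponents_row0 oppr0.
Qed.

Lemma trop_degreeD B C : trop_degree (B + C) <= trop_degree B + trop_degree C.
Proof.
rewrite -big_split/=; apply: ler_sum => j _; apply: pole_order_le => i.
by rewrite homog_exponentsD mxE opprD lerD// le_bigmax.
Qed.

Lemma trop_degreeZ a B : 0 <= a -> trop_degree (a *: B) = a * trop_degree B.
Proof.
move=> a0; rewrite mulr_sumr; apply: eq_bigr => j _.
rewrite /pole_order (big_morph ( *%R a) (id1 := 0) (op1 := Num.max)) ?mulr0//.
  by apply: eq_bigr => i _; rewrite homog_exponentsZ mxE mulrN.
by move=> x y; rewrite maxr_pMr.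
Qed.

Lemma trop_degree_bound B e : 0 <= e -> (forall i j, `|B i j| <= e) ->
  trop_degree B <= (1 + n)%:R ^+ 2 * e.
Proof.
move=> e0 Be; have Ee i j : - homog_exponents B i j <= (1 + n)%:R * e.
  have e_le : e <= (1 + n)%:R * e by rewrite ler_peMl// ler1n.
  case: (split_ordP i) => k -> {i}.
    by rewrite ord1 homog_exponents_row0 oppr0 (le_trans e0).
  case: (split_ordP j) => l -> {j}; last first.
    rewrite homog_exponents_rowr (le_trans _ e_le)// (le_trans (ler_norm _))//.
    by rewrite normrN.
  rewrite /homog_exponents block_mxEdl !mxE opprK.
  rewrite (le_trans (ler_norm _))// (le_trans (ler_norm_sum _ _ _))//.
  apply: (@le_trans _ _ (\sum_(i < n) e)).
    by apply: ler_sum => i _; rewrite mxE mulr1.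
  rewrite sumr_const card_ord -[X in X <= _]mulr_natl ler_wpM2r//.
  by rewrite ler_nat leq_addl.
apply: (@le_trans _ _ (\sum_(j < 1 + n) (1 + n)%:R * e)).
  by apply: ler_sum => j _; apply: pole_order_le.
by rewrite sumr_const card_ord expr2 -mulrA [X in _ <= X]mulr_natl.
Qed.

Lemma trop_degree_lipschitz B C e : 0 <= e -> (forall i j, `|C i j| <= e) ->
  `|trop_degree (B + C) - trop_degree B| <= (1 + n)%:R ^+ 2 * e.
Proof.
move=> e0 Ce; rewrite ler_distlC; apply/andP; split.
  rewrite lerBlDr (le_trans (trop_degreeD _ _))// lerD2l.
  exact: trop_degree_bound.
rewrite -{1}(addrK C B) (le_trans (trop_degreeD _ _))// lerD2l.
by apply: trop_degree_bound => // i j; rewrite mxE normrN.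
Qed.

End Sublinearity.

Lemma trop_degree_intr (T : realDomainType) n (B : 'M[int]_n) :
  trop_degree (map_mx intr B : 'M[T]_n) = (trop_degree B)%:~R.
Proof.
have mapE : homog_exponents (map_mx intr B : 'M[T]_n) =
            map_mx intr (homog_exponents B).
  rewrite map_block_mx !map_mx0 map_mxN map_mxM.
  by congr (block_mx _ _ (- (_ *m _)) _); apply/matrixP => i j; rewrite !mxE.
rewrite [RHS]rmorph_sum/=; apply: eq_bigr => j _.
rewrite /pole_order (big_morph intr (id1 := 0) (op1 := Num.max)) ?mulr0z//.
  by apply: eq_bigr => i _; rewrite mapE mxE rmorphN.
move=> x y; case: (leP x y) => xy; first by rewrite max_r ?ler_int.
by rewrite max_l ?ler_int// ltW.
Qed.

(** * The degree bounds the spectral radius *)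

Section SpectralRadius.
Variable R : rcfType.
Implicit Types (x y : R[i]).

Lemma norm_normc x : `|x| = (normc x)%:C%C.
Proof. by rewrite normc_def; case: x. Qed.

Lemma normc_ge0 x : 0 <= normc x.
Proof. by case: x => a b; exact: sqrtr_ge0. Qed.

Lemma normc_real (a : R) : normc a%:C%C = `|a|.
Proof. by rewrite /= expr0n addr0 sqrtr_sqr. Qed.

Lemma normc_sum (I : finType) (F : I -> R[i]) :
  normc (\sum_i F i) <= \sum_i normc (F i).
Proof.
elim/big_ind2: _ => [|x a y b xa yb|//]; first by rewrite ComplexField.Normc.normc0.
by rewrite (le_trans (le_normcD _ _))// lerD.
Qed.

(** Two barycenters of points with mutual distances at most [delta] are at
    distance at most [delta]; here with nonnegative weights of total mass [D],
    by writing [D] times the difference as a double sum of the differences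
    [y j - y k]. *)
Lemma normc_barycenter_diff m (p q : 'I_m -> R) (y : 'I_m -> R[i]) D delta :
    (forall j, 0 <= p j) -> (forall j, 0 <= q j) ->
    \sum_j p j = D -> \sum_j q j = D ->
    (forall j k, normc (y j - y k) <= delta) ->
  normc (\sum_j (p j - q j)%:C%C * y j) <= D * delta.
Proof.
move=> p0 q0 pD qD yd; have D0 : 0 <= D by rewrite -pD sumr_ge0.
have [DE|DN0] := eqVneq D 0.
  rewrite DE mul0r big1 ?ComplexField.Normc.normc0// => j _.
  have pj : p j = 0 by apply: (psumr_eq0P _ (etrans pD DE)).
  have qj : q j = 0 by apply: (psumr_eq0P _ (etrans qD DE)).
  by rewrite pj qj subrr mul0r.
have Dgt0 : 0 < D by rewrite lt_def DN0.
rewrite -(ler_pM2l Dgt0).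
rewrite -{1}(ger0_norm D0) -normc_real -ComplexField.Normc.normcM.
have -> : D%:C%C * (\sum_j (p j - q j)%:C%C * y j) =
    \sum_j \sum_k (p j * q k)%:C%C * (y j - y k).
  transitivity (\sum_j \sum_k ((p j * q k)%:C%C * y j)
                - \sum_j \sum_k ((p j * q k)%:C%C * y k)); last first.
    by rewrite -sumrB; apply: eq_bigr => j _; rewrite -sumrB;
      apply: eq_bigr => k _; rewrite mulrBr.
  rewrite [X in _ - X]exchange_big/= -sumrB mulr_sumr.
  apply: eq_bigr => j _; rewrite -!mulr_suml -!rmorph_sum/=.
  rewrite -mulr_sumr -mulr_suml pD qD -mulrBl mulrA -rmorphM -rmorphB/=.
  by rewrite mulrBr [p j * D]mulrC.
rewrite (le_trans (normc_sum _))//.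
rewrite [D * (D * _)](_ : _ = \sum_j \sum_k p j * q k * delta); last first.
  rewrite mulrA -{1}pD -{1}qD !mulr_suml; apply: eq_bigr => j _.
  by rewrite mulr_sumr mulr_suml.
apply: ler_sum => j _; rewrite (le_trans (normc_sum _))//.
apply: ler_sum => k _; rewrite ComplexField.Normc.normcM normc_real.
by rewrite ger0_norm ?mulr_ge0// ler_wpM2l// mulr_ge0.
Qed.

(** Rows of [homog_exponents B] become nonnegative of sum [trop_degree B] once
    the pole orders are added, and the pole orders cancel in differences of
    rows.  So [homog_exponents B] expands the diameter of the coordinates of
    [(0, v)] by a factor at most [trop_degree B]; the extra coordinate 0 makes
    the diameter positive. *)
Lemma eigenvalue_le_trop_degree n (B : 'M[R]_n) (v : 'cV[R[i]]_n) lam :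
    v != 0 -> map_mx (real_complex R) B *m v = lam *: v ->
  normc lam <= trop_degree B.
Proof.
move=> vN0 Bv.
pose E := homog_exponents B.
pose y : 'cV[R[i]]_(1 + n) := col_mx 0 v.
have Ey : map_mx (real_complex R) E *m y = lam *: y.
  rewrite /E /homog_exponents map_block_mx !map_mx0 mul_block_col.
  by rewrite !mul0mx mulmx0 !add0r Bv scale_col_mx scaler0.
pose f (q : 'I_(1 + n) * 'I_(1 + n)) := normc (y q.1 0 - y q.2 0).
pose q0 : 'I_(1 + n) * 'I_(1 + n) := (0, 0).
case: (@Order.TotalTheory.arg_maxP _ _ _ q0 xpredT f isT) => -[i k] _ max_ik.
have delta_gt0 : 0 < f (i, k).
  rewrite lt_def normc_ge0 andbT; apply: contra vN0 => /eqP f0.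
  apply/eqP/colP => j; rewrite mxE; apply: ComplexField.Normc.eq0_normc.
  apply/le_anti; rewrite normc_ge0 andbT -f0.
  have : normc (y (rshift 1 j) 0 - y (lshift n 0) 0) <= f (i, k).
    exact: max_ik (rshift 1 j, lshift n 0) isT.
  by rewrite /y col_mxEd col_mxEu mxE subr0.
have Eyi l : lam * y l 0 = \sum_j (E l j)%:C%C * y j 0.
  by have /colP/(_ l) := Ey; rewrite !mxE => <-; apply: eq_bigr => j _; rewrite mxE.
rewrite -(ler_pM2r delta_gt0) {1}/f /= -ComplexField.Normc.normcM mulrBr !Eyi.
rewrite -sumrB; under eq_bigr do rewrite -mulrBl -rmorphB/=.
pose s l j := E l j + pole_order B j.
have -> : \sum_j (E i j - E k j)%:C%C * y j 0 = \sum_j (s i j - s k j)%:C%C * y j 0.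
  by apply: eq_bigr => j _; rewrite /s opprD addrACA subrr addr0.
apply: (normc_barycenter_diff (p := s i) (q := s k)).
- by move=> j; exact: pole_order_ge.
- by move=> j; exact: pole_order_ge.
- exact: sum_shifted_exponents.
- exact: sum_shifted_exponents.
- by move=> j l; exact: (max_ik (j, l)).
Qed.

End SpectralRadius.

(** * Functions of a diagonalizable matrix *)

Section SpectralCalculus.
Variables (F : fieldType) (n : nat) (P : 'M[F]_n) (d : 'rV[F]_n).
Hypothesis Pu : P \in unitmx.
Implicit Type h : F -> F.

Definition spectral_mx h := invmx P *m diag_mx (map_mx h d) *m P.

Lemma spectral_mxE h i j :
  spectral_mx h i j = \sum_k invmx P i k * h (d 0 k) * P k j.
Proof.
by rewrite mxE; apply: eq_bigr => k _; rewrite mul_mx_diag !mxE.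
Qed.

Lemma spectral_mxP h : P *m spectral_mx h = diag_mx (map_mx h d) *m P.
Proof. by rewrite /spectral_mx !mulmxA mulmxV// mul1mx. Qed.

Lemma spectral_mx_unique h M :
  P *m M = diag_mx (map_mx h d) *m P -> M = spectral_mx h.
Proof. by move=> PM; rewrite /spectral_mx -mulmxA -PM mulKmx. Qed.

Lemma spectral_mx_col h k :
  spectral_mx h *m col k (invmx P) = h (d 0 k) *: col k (invmx P).
Proof.
rewrite [in LHS]colE mulmxA mulmxK// -colE.
by apply/colP => i; rewrite mul_mx_diag !mxE mulrC.
Qed.

Lemma col_invmx_neq0 k : col k (invmx P) != 0.
Proof.
apply/eqP => c0; have := congr1 (fun v => (P *m v) k 0) c0.
rewrite colE mulmxA mulmxV// mul1mx mulmx0 !mxE !eqxx => /eqP.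
by rewrite oner_eq0.
Qed.

Variable A : 'M[F]_n.
Hypothesis PA : P *m A = diag_mx d *m P.

Lemma spectral_mxX m : A ^+ m = spectral_mx (fun x => x ^+ m).
Proof.
apply: spectral_mx_unique; elim: m => [|m IH].
  by rewrite expr0 mulmx1; apply/matrixP => i j; rewrite mul_diag_mx !mxE mul1r.
rewrite exprSr mulmxA IH -mulmxA PA mulmxA; congr (_ *m _).
by rewrite mulmx_diag; congr diag_mx; apply/rowP => i; rewrite !mxE exprSr.
Qed.

Lemma eigenvalue_diag k : eigenvalue A (d 0 k).
Proof.
apply/eigenvalueP; exists (row k P).
  by rewrite -row_mul PA; apply/rowP => j; rewrite mul_diag_mx !mxE.
apply/eqP => r0; have := congr1 (fun v => (v *m invmx P) 0 k) r0.
by rewrite -row_mul mulmxV// mul0mx !mxE eqxx => /eqP; rewrite oner_eq0.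
Qed.

Lemma eigenvalue_diagP a : eigenvalue A a -> exists k, d 0 k = a.
Proof.
case/eigenvalueP => v vA vN0; pose w := v *m invmx P.
have wd : w *m diag_mx d = a *: w.
  have -> : diag_mx d = P *m A *m invmx P by rewrite PA mulmxK.
  by rewrite /w !mulmxA mulmxKV// vA scalemxAl.
have [k wk] : exists k, w 0 k != 0.
  apply/rV0Pn; apply: contra vN0 => /eqP w0.
  by rewrite -(mulmxKV Pu v) -/w w0 mul0mx.
exists k; apply: (mulfI wk).
by have /rowP/(_ k) := wd; rewrite mul_mx_diag !mxE [a * _]mulrC.
Qed.

(** Entry (i, j) of [W *m invmx P] vanishes unless [d 0 j = d' 0 i], so what
    [W] does to [A] it does to every function of [A]. *)
Lemma spectral_mx_intertwine h (W : 'M[F]_n) d' :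
    W *m A = diag_mx d' *m W ->
  W *m spectral_mx h = diag_mx (map_mx h d') *m W.
Proof.
move=> WA; pose X := W *m invmx P.
have Xd : X *m diag_mx d = diag_mx d' *m X.
  have -> : diag_mx d = P *m A *m invmx P by rewrite PA mulmxK.
  by rewrite /X !mulmxA mulmxKV// WA.
rewrite /spectral_mx !mulmxA -/X.
rewrite -[in RHS](mulmxKV Pu W) -/X [RHS]mulmxA; congr (_ *m _).
apply/matrixP => i j.
rewrite mul_mx_diag mul_diag_mx mxE [RHS]mxE ![map_mx h _ _ _]mxE.
have /matrixP/(_ i j) := Xd; rewrite mul_mx_diag mul_diag_mx mxE [RHS]mxE.
have [->|XN0] := eqVneq (X i j) 0; first by rewrite !(mul0r, mulr0).
by rewrite mulrC => /(mulIf XN0) ->; rewrite mulrC.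
Qed.

(** [map_mx s P] diagonalizes [A] as well, with eigenvalues [map_mx s d], and the
    value of a function of [A] does not depend on the diagonalization. *)
Lemma spectral_mx_morph (s : {rmorphism F -> F}) h :
    map_mx s A = A -> (forall x, h (s x) = s (h x)) ->
  map_mx s (spectral_mx h) = spectral_mx h.
Proof.
move=> sA sh; have sPu : map_mx s P \in unitmx by rewrite map_unitmx.
apply: (can_inj (mulKmx sPu)).
rewrite -map_mxM spectral_mxP map_mxM map_diag_mx.
rewrite (spectral_mx_intertwine h (d' := map_mx s d)).
  by congr (diag_mx _ *m _); apply/rowP => i; rewrite !mxE.
by rewrite -{1}sA -map_mxM PA map_mxM map_diag_mx.
Qed.

End SpectralCalculus.

(** * The dominant part of the powers of a matrix *)

Section Phase.
Variable R : rcfType.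

Lemma normcX (a : R[i]) m : normc (a ^+ m) = normc a ^+ m.
Proof.
elim: m => [|m IH]; first exact: ComplexField.Normc.normc1.
by rewrite !exprS ComplexField.Normc.normcM IH.
Qed.

(** [a / a^* = (a / |a|) ^+ 2]. *)
Lemma phase_root_of_unity (a : R[i]) m : (0 < m)%N -> m.-unity_root (a / a^*) ->
  0 < normc a /\ (a / (normc a)%:C%C) ^+ (2 * m) = 1.
Proof.
move=> m0 /unity_rootP am.
have aN0 : a != 0.
  apply: contra_eqN am => /eqP ->.
  by rewrite mul0r expr0n gtn_eqF// eq_sym oner_eq0.
split.
  by rewrite -ltcR -norm_normc normr_gt0.
rewrite exprM -am; congr (_ ^+ m); rewrite -norm_normc expr_div_n normCK.
by rewrite expr2 -mulf_div divff// mul1r.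
Qed.

End Phase.

Section DominantPart.
Variables (R : rcfType) (n : nat) (A : 'M[int]_n) (rho : R).
Variables (P : 'M[R[i]]_n) (d : 'rV[R[i]]_n).
Hypothesis Pu : P \in unitmx.
Hypothesis PA : P *m complex_mx R A = diag_mx d *m P.
Hypothesis rho_gt0 : 0 < rho.

Definition dominant_phase l (a : R[i]) : R[i] :=
  if normc a == rho then (a / rho%:C%C) ^+ l else 0.

(** The limit of [A ^+ m / rho ^+ m] along the [m] for which the dominant phases
    agree with their [l]-th powers.  It is a real matrix by [dominant_mxE], so
    that taking real parts only changes its type. *)
Definition dominant_mx l : 'M[R]_n :=
  map_mx (@complex.Re R) (spectral_mx P d (dominant_phase l)).

Lemma dominant_mxE l :
  map_mx (real_complex R) (dominant_mx l) = spectral_mx P d (dominant_phase l).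
Proof.
have conjM : map_mx Num.conj (spectral_mx P d (dominant_phase l)) =
    spectral_mx P d (dominant_phase l).
  apply: (spectral_mx_morph Pu PA).
    by apply/matrixP => i j; rewrite !mxE rmorph_int.
  move=> a; rewrite /dominant_phase.
  have -> : normc a^* = normc a.
    by have := norm_conjC a; rewrite !norm_normc => -[].
  case: eqP => _; last by rewrite rmorph0.
  rewrite rmorphXn rmorphM fmorphV/=; congr ((_ / _) ^+ _).
  by rewrite -[LHS]conjc_real.
apply/matrixP => i j; rewrite /dominant_mx -map_mx_comp [LHS]mxE /=.
by apply: RRe_real; apply/CrealP; have /matrixP/(_ i j) := conjM; rewrite mxE.
Qed.

(** The dominant matrix has the eigenvalue [(d 0 k / rho) ^+ l], of modulus 1. *)
Lemma dominant_degree_ge1 l k : normc (d 0 k) = rho ->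
  1 <= trop_degree (dominant_mx l).
Proof.
move=> dk; have := eigenvalue_le_trop_degree (col_invmx_neq0 Pu k).
move=> /(_ (dominant_mx l) (dominant_phase l (d 0 k))).
rewrite dominant_mxE spectral_mx_col// /dominant_phase dk eqxx => /(_ erefl).
have phase1 : normc (d 0 k / rho%:C%C) = 1.
  rewrite ComplexField.Normc.normcM ComplexField.Normc.normcV dk normc_real.
  by rewrite gtr0_norm// divff// gt_eqF.
by rewrite normcX phase1 expr1n.
Qed.

(** The bound [t] is left free so as to cover both a second modulus, with
    [t = rho2 ^+ m], and a single modulus, with [t = 0] and an exact formula. *)
Lemma dominant_approx : exists2 K, 0 <= K & forall l m t, 0 <= t ->
    (forall k,
      normc (d 0 k ^+ m - (rho ^+ m)%:C%C * dominant_phase l (d 0 k)) <= t) ->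
  `|(trop_degree (A ^+ m))%:~R - rho ^+ m * trop_degree (dominant_mx l)| <= K * t.
Proof.
pose N : R := \sum_i \sum_j \sum_k normc (invmx P i k) * normc (P k j).
exists ((1 + n)%:R ^+ 2 * N).
  rewrite mulr_ge0 ?exprn_ge0//; do 3 (apply: sumr_ge0 => ? _).
  by rewrite mulr_ge0// normc_ge0.
move=> l m t t0 dt; rewrite -trop_degree_intr -trop_degreeZ; last first.
  exact/exprn_ge0/ltW.
pose M : 'M[R]_n := rho ^+ m *: dominant_mx l.
pose E := map_mx intr (A ^+ m) - M.
have -> : map_mx intr (A ^+ m) = M + E by rewrite addrC subrK.
rewrite -mulrA; apply: trop_degree_lipschitz => [|i j].
  rewrite mulr_ge0//; do 3 (apply: sumr_ge0 => ? _).
  by rewrite mulr_ge0// normc_ge0.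
rewrite -normc_real.
have -> : (E i j)%:C%C = \sum_k invmx P i k *
    (d 0 k ^+ m - (rho ^+ m)%:C%C * dominant_phase l (d 0 k)) * P k j.
  transitivity ((complex_mx R A ^+ m) i j
      - (rho ^+ m)%:C%C * (map_mx (real_complex R) (dominant_mx l)) i j).
    rewrite /complex_mx -rmorphXn/= /E /M; move: (dominant_mx l) => D.
    by rewrite !mxE rmorphB rmorphM/= rmorph_int.
  have -> : (complex_mx R A ^+ m) i j = \sum_k invmx P i k * d 0 k ^+ m * P k j.
    by rewrite (spectral_mxX Pu PA) spectral_mxE.
  have -> : map_mx (real_complex R) (dominant_mx l) i j =
      \sum_k invmx P i k * dominant_phase l (d 0 k) * P k j.
    by rewrite dominant_mxE spectral_mxE.
  rewrite mulr_sumr -sumrB; apply: eq_bigr => k _.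
  rewrite mulrBr mulrBl !mulrA; congr (_ - _ * _ * _); exact: mulrC.
rewrite (le_trans (normc_sum _))//.
apply: (@le_trans _ _ ((\sum_k normc (invmx P i k) * normc (P k j)) * t)).
  rewrite mulr_suml; apply: ler_sum => k _.
  rewrite !ComplexField.Normc.normcM mulrAC ler_wpM2l//.
  by rewrite mulr_ge0// normc_ge0.
pose S i j := \sum_k normc (invmx P i k) * normc (P k j).
have S0 i' j' : 0 <= S i' j'.
  by apply: sumr_ge0 => k _; rewrite mulr_ge0// normc_ge0.
rewrite ler_wpM2r// -[X in X <= _]/(S i j) -[N]/(\sum_i \sum_j S i j).
rewrite [leRHS](bigD1 i)//= (bigD1 j)//= -addrA lerDl addr_ge0//.
  by apply: sumr_ge0.
by apply: sumr_ge0 => ? _; apply: sumr_ge0.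
Qed.

End DominantPart.

From mathcomp Require Import all_classical all_reals all_analysis.
Import numFieldNormedType.Exports.
Local Open Scope classical_set_scope.
Local Open Scope ring_scope.

Unset Implicit Arguments.
Set Strict Implicit.

(** * Degree growth *)

Theorem theorem6p8 (R : realType) (n : nat) (A : 'M[int]_n) (rho1 : R)
  (detA : \det A != 0)
  (diagA : diagonalizable (complex_mx R A))
  (rho1_max : max_modulus A rho1)
  (rootA : forall a : R[i], eigenvalue (complex_mx R A) a ->
     ComplexField.Normc.normc a = rho1 ->
     exists2 m : nat, (0 < m)%N & m.-unity_root (a / a^*)) :
  let deg k : R := (ratmap_degree (iter k (@monomial_map R[i] n A)))%:R in
  exists (p : nat) (C : 'I_p -> R),
    [/\ (0 < p)%N,
        forall l, 1 <= C l,
        forall (rho2 : R), second_modulus A rho1 rho2 ->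
          forall l : 'I_p,
            (fun k : nat => deg (p * k + l)%N) =
            (fun k : nat => C l * rho1 ^+ (p * k + l)) +O_\oo
            (fun k : nat => rho2 ^+ (p * k + l))
      & (forall r, eigen_modulus A r -> r = rho1) ->
          forall (l : 'I_p) (k : nat),
            deg (p * k + l)%N = C l * rho1 ^+ (p * k + l)].
Proof.
move=> deg; case: diagA => P Pu /similar_diagPex[d /(similarP Pu) PA].
have degE m : deg m = (trop_degree (A ^+ m))%:~R.
  by rewrite /deg Degree.ratmap_degree_iter natr_absz ger0_norm ?trop_degree_ge0.
have modulus_d k : eigen_modulus A (normc (d 0 k)).
  by exists (d 0 k); first exact: (eigenvalue_diag Pu PA k).
have [[a a_ev a_rho] rho1_ge] := rho1_max.
have rho1_gt0 : 0 < rho1.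
  have [m m0 am] := rootA a a_ev a_rho.
  by have [] := phase_root_of_unity m0 am; rewrite a_rho.
have [k0 dk0] : exists k, normc (d 0 k) = rho1.
  by have [k dk] := eigenvalue_diagP Pu PA a_ev; exists k; rewrite dk.
(* p is the product of one exponent per diagonal entry; entries of smaller
   modulus contribute the exponent 1. *)
have [p p_gt0 phase_p] : exists2 p : nat, (0 < p)%N &
    forall k, normc (d 0 k) = rho1 -> (d 0 k / rho1%:C%C) ^+ p = 1.
  have /fin_all_exists[m mP] : forall k, exists m : nat, (0 < m)%N /\
      (normc (d 0 k) = rho1 -> (d 0 k / rho1%:C%C) ^+ m = 1).
    move=> k; have [dk|dkN] := eqVneq (normc (d 0 k)) rho1; last first.
      by exists 1%N; split=> // dk; rewrite dk eqxx in dkN.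
    have [m m0 dm] := rootA _ (eigenvalue_diag Pu PA k) dk.
    have [_ dm1] := phase_root_of_unity m0 dm.
    by exists (2 * m)%N; rewrite muln_gt0 m0 -dk; split.
  exists (\prod_k m k)%N; first by apply: prodn_gt0 => k; case: (mP k).
  move=> k dk; rewrite (bigD1 k)//= exprM.
  by have [_ ->] := mP k; rewrite ?expr1n.
have [K K0 approx] := dominant_approx Pu PA rho1_gt0.
pose err m l k := d 0 k ^+ m - (rho1 ^+ m)%:C%C * dominant_phase rho1 l (d 0 k).
have err_top k l q : normc (d 0 k) = rho1 -> err (p * q + l)%N l k = 0.
  move=> dk; rewrite /err /dominant_phase dk eqxx.
  have -> : (d 0 k / rho1%:C%C) ^+ l = (d 0 k / rho1%:C%C) ^+ (p * q + l).
    by rewrite exprD exprM phase_p// expr1n mul1r.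
  rewrite rmorphXn/= -exprMn mulrC divfK ?subrr//.
  by rewrite -(rmorph0 (real_complex R)) (inj_eq (@complexI _)) gt_eqF.
have err_low k m l : normc (d 0 k) != rho1 -> err m l k = d 0 k ^+ m.
  by move=> dk; rewrite /err /dominant_phase (negbTE dk) mulr0 subr0.
exists p, (fun l => trop_degree (dominant_mx rho1 P d l)); split=> //.
- by move=> l; exact: (dominant_degree_ge1 Pu PA rho1_gt0 l dk0).
- move=> rho2 [[b _ b_rho] rho2_lt rho2_max] l; apply/eqaddOP.
  have rho2_ge0 : 0 <= rho2 by rewrite -b_rho normc_ge0.
  exists K; split; first exact: ger0_real.
  move=> K' /ltW KK'; apply: nearW => q /=.
  rewrite [X in `|X| <= _](_ : _ = (trop_degree (A ^+ (p * q + l)))%:~R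
      - rho1 ^+ (p * q + l) * trop_degree (dominant_mx rho1 P d l)); last first.
    by rewrite -degE [rho1 ^+ _ * _]mulrC.
  rewrite [X in _ <= _ * X]ger0_norm ?exprn_ge0//.
  apply: (@le_trans _ _ (K * rho2 ^+ (p * q + l))); last first.
    by rewrite ler_wpM2r ?exprn_ge0.
  apply: approx => [|k]; first exact: exprn_ge0.
  rewrite -/(err _ _ _); have [dk|dk] := eqVneq (normc (d 0 k)) rho1.
    by rewrite err_top// ComplexField.Normc.normc0 exprn_ge0.
  rewrite err_low// normcX lerXn2r ?nnegrE ?normc_ge0//.
  by apply: rho2_max; rewrite // lt_neqAle dk rho1_ge.
- move=> all_rho l q; apply/eqP; rewrite -subr_eq0 -normr_le0 degE.
  rewrite [_ * rho1 ^+ _]mulrC -(mulr0 K); apply: approx => // k.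
  by rewrite -/(err _ _ _) err_top ?ComplexField.Normc.normc0//; exact: all_rho.
Qed.
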